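(* Let $X\subset\mathcal L$, let $f\in X$, let $n\ge 1$, and let $Y_i=f\left(\frac{i-1}{n}\right)+\epsilon_i$, $i=1,\dots,n$, where $\epsilon_1,\dots,\epsilon_n$ are independent real random variables with mean zero such that for some $\kappa>0$, $v>0$ and all integers $m\ge 2$ one has $\mathbb E|\epsilon_i|^m\le v\, m!\,\kappa^{m-2}/2$ for all $i$. Then for every $\delta>0$, $$\mathbb P\left(\max_{j\in\mathbb N_0}|s_j(Y^{(n)})-s_j(f^{(n)})|\ge\delta\right)\le 2\exp\left(-\frac{\delta^2 n}{2v+2\kappa\delta}\right).$$
   Context: $\mathcal L^\infty$ is the space of Lebesgue-measurable essentially bounded functions $[0,1]\to\mathbb R$ (genuine functions, not equivalence classes). With $t^-(\delta)=\max(0,t-\delta)$, $t^+(\delta)=\min(1,t+\delta)$, let $\mathcal L$ be the set of $f\in\mathcal L^\infty$ with $f(t)=\lim_{\epsilon\to0}\inf_{0<\delta<\epsilon}\frac{1}{t^+(\delta)-t^-(\delta)}\int_{t^-(\delta)}^{t^+(\delta)}f(s)\,ds$ for all $t\in[0,1]$ (each a.e.-class in $\mathcal L^\infty$ has exactly one representative in $\mathcal L$). The Kolmogorov distance is $d_K(f,g)=\sup_{x\in[0,1]}\left|\int_0^x (f(s)-g(s))\,ds\right|$. Number of modes: for $g:[0,1]\to\mathbb R$ and a partition $P$: $0=t_0<\dots<t_{N}=1$, let $M(g,P)$ be the number of indices $0<i<N$ with $\max(g(t_{i-1}),g(t_{i+1}))<g(t_i)$, and let $M(g)=\sup_P M(g,P)$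 over all finite partitions. For $n\ge1$ let $PC_n$ be the set of $g\in\mathcal L$ that are constant on each open interval $\left(\frac{i-1}{n},\frac in\right)$, $i=1,\dots,n$. Let $X^{(n)}_j=\{g\in PC_n: M(g)\le j\}$, and for $g\in PC_n$ let $s_j(g)=\inf_{h\in X_j^{(n)}}d_K(g,h)$, $j\in\mathbb N_0$. Let $f^{(n)}\in PC_n$ be the function with value $f\left(\frac{i-1}{n}\right)$ on $\left(\frac{i-1}{n},\frac in\right)$, and $Y^{(n)}\in PC_n$ the (random) function with value $Y_i$ on $\left(\frac{i-1}{n},\frac in\right)$, $i=1,\dots,n$. *)

(* Defs.v *)
From HB Require Import structures.
From mathcomp Require Import all_boot all_order all_algebra.
From mathcomp Require Import all_classical all_reals all_analysis.
From mathcomp Require Import measurable_realfun lra.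

Set Implicit Arguments.
Unset Strict Implicit.
Unset Printing Implicit Defensive.

Import Order.TTheory GRing.Theory Num.Theory.
Import numFieldNormedType.Exports.

Local Open Scope classical_set_scope.
Local Open Scope ring_scope.

(* Functions [0,1] -> R are represented by functions R -> R; every definition
   below depends only on their values on [0,1]. *)

Section function_spaces.
Context {R : realType}.
Notation leb := (@completed_lebesgue_measure R).
Notation lebT := (caratheodory_type (@wlength R idfun)^*%mu).
Implicit Types (f g h : R -> R) (t x delta eps : R) (j n : nat).

(* Lebesgue (not merely Borel) measurability: the domain carries the
   sigma-algebra of the completed Lebesgue measure. *)
Definition Linfty : set (R -> R) :=
  [set f | measurable_fun (`[0, 1]%classic : set lebT) (f : lebT -> R) /\
    exists M : R, {ae leb, forall s, s \in `[0, 1] -> `|f s| <= M}].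

Definition tminus t delta : R := Num.max 0 (t - delta).
Definition tplus t delta : R := Num.min 1 (t + delta).

Definition avg f t delta : R :=
  (tplus t delta - tminus t delta)^-1 *
  \int[leb]_(s in `[tminus t delta, tplus t delta]) f s.

Definition calL : set (R -> R) :=
  [set f | Linfty f /\
    forall t, t \in `[0, 1] ->
      (fun eps => inf [set avg f t delta | delta in `]0, eps[%classic])
        @ 0^'+ --> f t].

(* A bounded set for essentially bounded f and g, so that the real-valued [sup]
   is the supremum; likewise, the set in [s_] is nonempty (constant functions have
   no mode) and bounded below by 0. *)
Definition dK f g : R :=
  sup [set `|\int[leb]_(s in `[0, x]) (f s - g s)| | x in `[0, 1]%classic].

(* For the partition 0 = t_0 < ... < t_N = 1 with t = 0 :: s and N = size s,
   the number of modes among the indices 0 < i < N. *)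
Definition modes_on g (s : seq R) : nat :=
  let t := 0 :: s in
  count (fun i => Num.max (g t`_i.-1) (g t`_i.+1) < g t`_i)
        (iota 1 (size s).-1).

(* The supremum may be +oo. *)
Definition modes g : \bar R :=
  ereal_sup [set ((modes_on g s)%:R)%:E | s in itv_partition 0 1].

Definition PC n : set (R -> R) :=
  [set g | calL g /\
    forall i : 'I_n, exists c : R,
      forall t, i%:R / n%:R < t < i.+1%:R / n%:R -> g t = c].

Definition Xn n j : set (R -> R) :=
  [set g | PC n g /\ (modes g <= (j%:R)%:E)%E].

Definition s_ n j g : R := inf [set dK g h | h in Xn n j].

(* Cells are numbered from 0: cell i is the open interval (i/n, (i+1)/n). *)
Definition cellval n (y : 'I_n -> R) (k : nat) : R := oapp y 0 (insub k).

(* The element of PC_n with value y i on cell i. Membership in calL forces its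
   values on the grid: the mean of the two neighbouring cell values at an
   interior point k/n, and the value of the first (last) cell at 0 (at 1). Here
   the left cell of t has index ceil(t n) - 1 and the right one floor(t n), both
   truncated to the range 0..n-1; see [stepE] and [step_PC]. *)
Definition step n (y : 'I_n -> R) : R -> R := fun t =>
  (cellval y `|Num.ceil (t * n%:R)|%N.-1
   + cellval y (minn (Num.truncn (t * n%:R)) n.-1)) / 2.

End function_spaces.

Section step_facts.
Context {R : realType}.

Notation leb := (@completed_lebesgue_measure R).
Notation lebT := (caratheodory_type (@wlength R idfun)^*%mu).

Lemma leb_measurable (i : interval R) : measurable ([set` i] : set lebT).
Proof. by apply: sub_caratheodory; exact: measurable_itv. Qed.

Lemma leb_itv (i : interval R) :
  leb [set` i] = (if i.1 < i.2 then (i.2 : \bar R) - i.1 else 0)%E.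
Proof. exact: lebesgue_measure_itv. Qed.

Lemma step_cell n (y : 'I_n -> R) (k : nat) t : (k < n)%N ->
  k%:R / n%:R < t < k.+1%:R / n%:R -> step y t = cellval y k.
Proof.
move=> kn; have n0 : 0 < n%:R :> R by rewrite ltr0n (leq_trans _ kn).
rewrite ltr_pdivrMr// ltr_pdivlMr// => /andP[kt tk].
rewrite /step; have -> : Num.truncn (t * n%:R) = k.
  by apply: truncn_def; rewrite (ltW kt).
have -> : Num.ceil (t * n%:R) = k.+1%:Z.
  by apply: ceil_def; rewrite -[k.+1]addn1 PoszD addrK kt -PoszD addn1 ltW.
rewrite /= (minn_idPl _)//; last by rewrite -ltnS prednK// (leq_trans _ kn).
lra.
Qed.

Lemma stepE n (y : 'I_n -> R) (i : 'I_n) t :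
  i%:R / n%:R < t < i.+1%:R / n%:R -> step y t = y i.
Proof. by move/(step_cell y (ltn_ord i)) => ->; rewrite /cellval valK. Qed.

Lemma mono_measurable (m : R -> nat) (u : nat -> R) :
  {in `[0, 1] &, {homo m : a b / a <= b >-> (a <= b)%N}} ->
  measurable_fun (`[0, 1]%classic : set lebT) (u \o m : lebT -> R).
Proof.
move=> mm _ A mA.
have -> : `[0, 1] `&` (u \o m) @^-1` A =
    \bigcup_(k in u @^-1` A) (`[0, 1] `&` m @^-1` [set k]).
  apply/seteqP; split=> [x [x01 Ax]|x [k Ak [x01 /= xk]]]; first by exists (m x).
  by split => //=; rewrite xk.
apply: bigcup_measurable => k _; apply: sub_caratheodory.
apply: is_interval_measurable => a b [/= a01 ak] [/= b01 bk] c /andP[ac cb].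
have c01 : c \in `[0, 1].
  by move: a01 b01; rewrite !in_itv/= => /andP[? _] /andP[_ ?]; apply/andP; split; lra.
split => //=; apply/eqP; rewrite eqn_leq -{1}bk -ak.
by apply/andP; split; apply: mm.
Qed.

Lemma step_measurable n (y : 'I_n -> R) :
  measurable_fun (`[0, 1]%classic : set lebT) (step y : lebT -> R).
Proof.
rewrite (_ : step y = (fun t => ((cellval y \o
   (fun t => `|Num.ceil (t * n%:R)|%N.-1)) t
   + (cellval y \o (fun t => minn (Num.truncn (t * n%:R)) n.-1)) t) * 2^-1))//.
apply: measurable_funM; last exact: measurable_cst.
apply: measurable_funD; apply: mono_measurable => a b;
  rewrite !in_itv/= => /andP[a0 _] /andP[b0 _] ab.
- have : Num.ceil (a * n%:R) <= Num.ceil (b * n%:R).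
    by apply: le_ceil; rewrite ler_wpM2r.
  have : 0 <= Num.ceil (a * n%:R) by rewrite -(ceil0 R) le_ceil// mulr_ge0.
  case: (Num.ceil (a * n%:R)) => // p _; case: (Num.ceil (b * n%:R)) => // q.
  by rewrite lez_nat /= => pq; rewrite -!subn1 leq_sub2r.
- rewrite leq_min geq_minr andbT (leq_trans (geq_minl _ _))//.
  by apply: le_truncn; rewrite ler_wpM2r.
Qed.

Lemma step_bounded n (y : 'I_n -> R) t : `|step y t| <= \sum_i `|y i|.
Proof.
have cb k : `|cellval y k| <= \sum_i `|y i|.
  rewrite /cellval; case: insubP => [i _ _|_] /=.
    by rewrite (bigD1 i)//= lerDl sumr_ge0.
  by rewrite normr0 sumr_ge0.
rewrite /step normrM (ger0_norm (_ : 0 <= 2^-1)) ?invr_ge0//.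
rewrite ler_pdivrMr// (le_trans (ler_normD _ _))//.
set a := `|_|; set b := `|_|; have : a <= _ := cb _; have : b <= _ := cb _; lra.
Qed.

Lemma step_Linfty n (y : 'I_n -> R) : Linfty (step y).
Proof.
split; first exact: step_measurable.
by exists (\sum_i `|y i|); apply: aeW => /= s _; exact: step_bounded.
Qed.

Lemma step_integral n (y : 'I_n -> R) (a t b cl cr : R) :
  0 <= a -> a <= t -> t <= b -> b <= 1 ->
  (forall s, a <= s < t -> step y s = cl) ->
  (forall s, t < s <= b -> step y s = cr) ->
  \int[leb]_(s in `[a, b]) step y s = cl * (t - a) + cr * (b - t).
Proof.
move=> a0 at_ tb b1 yl yr.
have -> : `[a, b]%classic = (`[a, t[ `|` `[t, t]) `|` `]t, b] :> set R.
  apply/seteqP; split=> s /=; rewrite !in_itv/=.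
    move=> /andP[as_ sb]; have [st|ts|->] := ltgtP s t.
    - by left; left; rewrite as_.
    - by right; rewrite sb.
    - by left; right.
  move=> [[/andP[p q]|/andP[p q]]|/andP[p q]]; apply/andP; split; lra.
have sub (i : interval R) : {subset i <= `[0, 1]} ->
    (leb).-integrable [set` i] (EFin \o step y).
  move=> iab; have mi := leb_measurable i.
  apply: (@measurable_bounded_integrable _ _ _ (leb) (step y)) => //.
  - apply: (@le_lt_trans _ _ (leb `[0, 1]%classic)).
      by apply: le_measure; rewrite ?inE//; exact: leb_measurable.
    by rewrite leb_itv/= lte_fin ltr01 ltry.
  - by apply: measurable_funS (step_measurable y) => //; exact: leb_measurable.
  - exists (\sum_i `|y i|); split; first by rewrite num_real.
    by move=> x /ltW yx s _; exact: le_trans (step_bounded _ _) yx.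
have itvE : (`[a, t[ `|` `[t, t]) = `[a, t]%classic :> set R.
  apply/seteqP; split=> s /=; rewrite !in_itv/=.
    by move=> [/andP[p q]|/andP[p q]]; apply/andP; split; lra.
  move=> /andP[as_ st]; have [|] := ltP s t; first by left; rewrite as_.
  by right; rewrite st andbT.
have itvE2 : `[a, t]%classic `|` `]t, b] = `[a, b]%classic :> set R.
  apply/seteqP; split=> s /=; rewrite !in_itv/=.
    by move=> [/andP[p q]|/andP[p q]]; apply/andP; split; lra.
  move=> /andP[as_ sb]; have [|] := leP s t; first by left; rewrite as_.
  by right; rewrite sb andbT.
have m1 := leb_measurable `[a, t[; have m2 := leb_measurable `[t, t].
have m3 := leb_measurable `]t, b].
rewrite Rintegral_setU//; last 3 first.
- exact: measurableU.
- rewrite itvE itvE2; apply: sub => s; rewrite !in_itv/= => /andP[p q].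
  by apply/andP; split; lra.
- apply/disj_setPS => s [] /=; rewrite !in_itv/= => -[] /andP[p q] /andP[r z]; lra.
rewrite Rintegral_setU//; last 2 first.
- rewrite itvE; apply: sub => s; rewrite !in_itv/= => /andP[p q].
  by apply/andP; split; lra.
- by apply/disj_setPS => s [] /=; rewrite !in_itv/= => /andP[p q] /andP[r z]; lra.
rewrite [X in X + _ + _](@eq_Rintegral _ _ _ _ _ (cst cl)); last first.
  by move=> s; rewrite inE/= in_itv/= => /yl.
rewrite [X in _ + _ + X](@eq_Rintegral _ _ _ _ _ (cst cr)); last first.
  by move=> s; rewrite inE/= in_itv/= => /yr.
rewrite [X in _ + X + _](@eq_Rintegral _ _ _ _ _ (cst (step y t))); last first.
  by move=> s; rewrite inE/= in_itv/= => /andP[p q]; congr (step y); lra.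
have H c (i : interval R) : \int[leb]_(_ in [set` i]) c =
    c * fine (if i.1 < i.2 then (i.2 : \bar R) - i.1 else 0)%E.
  rewrite Rintegral_cst; last exact: leb_measurable.
  by congr (_ * fine _); exact: leb_itv.
rewrite !H /= !lte_fin ltxx mulr0 addr0.
congr (_ * _ + _ * _).
- by case: ltP => //= ?; lra.
- by case: ltP => //= ?; lra.
Qed.

Lemma step_PC n (y : 'I_n -> R) : (0 < n)%N -> PC n (step y).
Proof.
move=> n0; split; last by move=> i; exists (y i) => t; exact: stepE.
split; first exact: step_Linfty.
move=> t; rewrite in_itv/= => /andP[t0 t1].
have n0' : 0 < n%:R :> R by rewrite ltr0n.
set l := `|Num.ceil (t * n%:R)|%N.-1.
set r := minn (Num.truncn (t * n%:R)) n.-1.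
have tn0 : 0 <= t * n%:R by rewrite mulr_ge0.
have rn : (r < n)%N by rewrite /r gtn_min -[in X in _ || X](prednK n0) ltnSn orbT.
have rt : r%:R / n%:R <= t.
  rewrite ler_pdivrMr// (@le_trans _ _ (Num.truncn (t * n%:R))%:R)//.
    by rewrite ler_nat geq_minl.
  by rewrite truncn_le.
have tr : t < 1 -> t < r.+1%:R / n%:R.
  move=> tlt1; rewrite ltr_pdivlMr// (lt_le_trans (truncnS_gt _))// ler_nat ltnS.
  rewrite leq_min leqnn/= -ltnS prednK// truncn_lt_nat//.
  by rewrite gtr_pMl.
have [ln lt tl] : [/\ (l < n)%N, 0 < t -> l%:R / n%:R < t & t <= l.+1%:R / n%:R].
  have := ceil_itv (t * n%:R).
  have : 0 <= Num.ceil (t * n%:R) by rewrite -(ceil0 R) le_ceil.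
  have : Num.ceil (t * n%:R) <= n%:Z.
    by rewrite ceil_le_int -[leRHS]mul1r ler_pM2r.
  rewrite ltr_pdivrMr// ler_pdivlMr// /l.
  case: (Num.ceil _) => //= -[|p]; rewrite lez_nat /= => pn _ /andP[p1 p2].
    by split=> //; [move=> tp; rewrite pmulr_rgt0// | exact: le_trans p2 _].
  by split=> //; move=> _; move: p1; rewrite (_ : p.+1%:Z - 1 = p%:Z)// -[p.+1]addn1 PoszD addrK.
have sl s : l%:R / n%:R < s < t -> step y s = cellval y l.
  by move=> /andP[p q]; apply: step_cell => //; rewrite p (lt_le_trans q).
have sr s : t < s < r.+1%:R / n%:R -> step y s = cellval y r.
  by move=> /andP[p q]; apply: step_cell => //; rewrite q andbT (le_lt_trans _ p).
have stE : step y t = (cellval y l + cellval y r) / 2 by [].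
have : exists2 e0 : R, 0 < e0 & forall e, 0 < e < e0 -> avg (step y) t e = step y t.
  have [t00|tpos] := eqVneq t 0.
    have l0 : l = 0%N by rewrite /l t00 mul0r ceil0.
    have r0 : r = 0%N by rewrite /r t00 mul0r truncn0 min0n.
    exists (n%:R^-1) => [|e /andP[e0 en]]; first by rewrite invr_gt0.
    have en1 : n%:R^-1 <= 1 :> R by rewrite invf_le1// ler1n.
    have tm0 : tminus t e = t by rewrite /tminus t00 sub0r; apply/max_idPl; lra.
    have tp0 : tplus t e = t + e by rewrite /tplus t00 add0r; apply/min_idPr; lra.
    rewrite /avg tm0 tp0 (@step_integral _ _ _ t _ (cellval y l) (cellval y r))//.
    - rewrite stE l0 r0 subrr mulr0 add0r -mulrCA addrAC subrr add0r mulVf ?mulr1; last by rewrite gt_eqF.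
      lra.
    - lra.
    - by rewrite t00; lra.
    - by move=> s /andP[p q]; lra.
    - move=> s /andP[p q]; apply: sr; rewrite p/= r0 mul1r; lra.
  have {}tpos : 0 < t by rewrite lt_def tpos.
  have := lt tpos => {}lt.
  have [t11|tlt] := eqVneq t 1.
    have lr : cellval y l = cellval y r.
      congr (cellval y _); rewrite /l /r t11 mul1r (natrK n) (_ : n%:R = n%:~R)//.
      by rewrite intrKceil /=; exact/esym/minn_idPr/leq_pred.
    have ln0 : 0 <= l%:R / n%:R :> R by rewrite divr_ge0.
    exists (t - l%:R / n%:R) => [|e /andP[e0 en]]; first by rewrite subr_gt0.
    have tm0 : tminus t e = t - e by rewrite /tminus; apply/max_idPr; lra.
    have tp0 : tplus t e = t by rewrite /tplus t11; apply/min_idPl; lra.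
    rewrite /avg tm0 tp0 (@step_integral _ _ _ t _ (cellval y l) (cellval y r))//.
    - rewrite stE -lr subrr mulr0 addr0 opprB addrCA subrr addr0 mulrCA mulVf ?mulr1; last by rewrite gt_eqF.
      lra.
    - lra.
    - lra.
    - move=> s /andP[p q]; apply: sl; rewrite q andbT; lra.
    - by move=> s /andP[p q]; lra.
  have {}tlt : t < 1 by rewrite lt_neqAle tlt.
  have {}tr := tr tlt.
  have ln0 : 0 <= l%:R / n%:R :> R by rewrite divr_ge0.
  have rn1 : r.+1%:R / n%:R <= 1 :> R by rewrite ler_pdivrMr// mul1r ler_nat.
  exists (Num.min (t - l%:R / n%:R) (r.+1%:R / n%:R - t)) => [|e /andP[e0]].
    by rewrite lt_min !subr_gt0 lt.
  rewrite lt_min => /andP[e1 e2].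
  have tm0 : tminus t e = t - e by rewrite /tminus; apply/max_idPr; lra.
  have tp0 : tplus t e = t + e by rewrite /tplus; apply/min_idPr; lra.
  rewrite /avg tm0 tp0 (@step_integral _ _ _ t _ (cellval y l) (cellval y r))//.
  - rewrite stE (_ : t - (t - e) = e); last lra.
    rewrite (_ : t + e - t = e); last lra.
    rewrite (_ : t + e - (t - e) = 2 * e); last lra.
    rewrite -mulrDl mulrC invfM mulrA [_ * e * _]mulrAC mulrK//.
    by rewrite unitfE gt_eqF.
  - lra.
  - lra.
  - lra.
  - lra.
  - move=> s /andP[p q]; apply: sl; rewrite q andbT; lra.
  - move=> s /andP[p q]; apply: sr; rewrite p/=; lra.
move=> [e0 e0pos avgE].
apply: (@cvg_trans _ (nbhs (step y t))) => //.
apply: cvg_near_cst; near=> e.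
have e_gt0 : 0 < e by near: e; exact: nbhs_right_gt.
have e_lt : e < e0 by near: e; exact: nbhs_right_lt.
rewrite (_ : [set _ | _ in _] = [set step y t]) ?inf1//.
apply/seteqP; split=> x /=.
  move=> [u]; rewrite in_itv/= => /andP[u0 ue] <-; rewrite avgE// u0.
  exact: lt_trans e_lt.
move=> ->; exists (e / 2); first by rewrite in_itv/=; apply/andP; split; lra.
by rewrite avgE//; apply/andP; split; lra.
Unshelve. all: by end_near. Qed.

End step_facts.

Definition mutually_independent (d : measure_display) (T : measurableType d)
    (R : realType) (P : probability T R) (I : finType)
    (eps : I -> {RV P >-> R}) : Prop :=
  forall (J : {set I}) (A : I -> set R), (forall i, measurable (A i)) ->
    P (\bigcap_(i in [set` J]) (eps i @^-1` A i)) =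
    (\prod_(i in J) P (eps i @^-1` A i))%E.

(* Main.v *)
(* The map g |-> s_j(g) is 1-Lipschitz for d_K, so the maximum over j is at most
   d_K(Y^(n), f^(n)), which is the maximum over k <= n of |S_k| / n for the
   partial sums S_k of the errors.  The tail of max_k |S_k| is bounded by
   exponential moments: stopping exp(l S_k) when it first reaches the level c
   gives a nonnegative process whose expectation grows at each step by at most
   the factor E exp(l eps_i), which the moment hypothesis bounds as in
   Bernstein's inequality; then Markov's inequality and l = delta / (v + kappa
   delta), with both signs. *)

Require Import Defs.
From HB Require Import structures.
From mathcomp Require Import all_boot all_order all_algebra.
From mathcomp Require Import all_classical all_reals all_analysis.
From mathcomp Require Import measurable_realfun ring lra.

Import Order.TTheory GRing.Theory Num.Theory.
Import numFieldNormedType.Exports.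

Local Open Scope classical_set_scope.
Local Open Scope ring_scope.

Set Implicit Arguments.
Unset Strict Implicit.

(** * The Kolmogorov distance on essentially bounded functions, and the Lipschitz property of
    [s_] *)

Section kolmogorov.
Context (R : realType).
Notation leb := (@completed_lebesgue_measure R).
Notation lebT := (caratheodory_type (@wlength R idfun)^*%mu).
Implicit Types (f g h : R -> R) (x : R).

Lemma Linfty_integrable f x : Linfty f -> x \in `[0, 1] ->
  leb.-integrable `[0, x]%classic (EFin \o f).
Proof.
move=> [mf [M fM]]; rewrite in_itv/= => /andP[x0 x1].
apply: (@integrableS _ _ _ leb `[0, 1]%classic).
- exact: leb_measurable.
- exact: leb_measurable.
- by apply: subset_itvl; rewrite bnd_simp.
apply/integrableP; split; first exact/measurable_EFinP.
(* The constant has to be nonnegative for the monotonicity of the integral, hence [|M|] in absolute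
   value. *)
apply: (@le_lt_trans _ _ (integral leb `[0, 1]%classic (cst (`|M|%:E)))).
  have m01 := @leb_measurable R `[0, 1].
  have mabs := measurableT_comp (@abse_measurable R setT) ((measurable_EFinP _ _).2 mf).
  apply: (ae_ge0_le_integral m01 _ mabs _ (measurable_cst _)).
  - by move=> s _; exact: abse_ge0.
  - by move=> s _; rewrite /cst lee_fin.
  - have [N [mN N0 sN]] := fM; exists N; split=> //.
    apply: subset_trans sN => s; apply: contra_not => sM s01 /=.
    by rewrite lee_fin (le_trans _ (ler_norm M))// sM.
rewrite integral_cst; last exact: leb_measurable.
have := @leb_itv R `[0, 1]; rewrite /= lte_fin ltr01 => ->.
by rewrite -EFinB -EFinM; exact: ltry.
Qed.

(** The bound is the L1 distance on [0,1]. It makes the [sup] in [dK] a genuine supremum and not a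
    default value. *)
Lemma dK_set_ubound f g : Linfty f -> Linfty g ->
  has_ubound [set `|\int[leb]_(s in `[0, x]) (f s - g s)| | x in `[0, 1]%classic].
Proof.
move=> Lf Lg; exists (\int[leb]_(s in `[0, 1]) `|f s - g s|) => _ [x x01 <-].
have i1 : (1 : R) \in `[0, 1] by rewrite in_itv/= ler01 lexx.
have ifg y : y \in `[0, 1] -> leb.-integrable `[0, y]%classic (fun s => (f s - g s)%:E).
  move=> y01; have m0y := @leb_measurable R `[0, y].
  exact: (integrableB m0y (Linfty_integrable Lf y01) (Linfty_integrable Lg y01)).
apply: le_trans (le_normr_Rintegral _ (ifg _ x01)) _; first exact: leb_measurable.
have nfg y : y \in `[0, 1] ->
    integral leb `[0, y]%classic (fun s => (`|f s - g s|)%:E) \is a fin_num.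
  move=> y01; rewrite ge0_fin_numE ?integral_ge0//.
  by have /integrableP[_] := ifg _ y01.
apply: fine_le; rewrite ?nfg//.
apply: ge0_subset_integral.
- exact: leb_measurable.
- exact: leb_measurable.
- have /integrableP[mfg _] := ifg _ i1.
  exact: (measurableT_comp (@abse_measurable R setT) mfg).
- by move=> s _; rewrite lee_fin.
- by move: x01; rewrite /= in_itv/= => /andP[_ x1]; apply: subset_itvl; rewrite bnd_simp.
Qed.

Lemma le_dK f g x : Linfty f -> Linfty g -> x \in `[0, 1] ->
  `|\int[leb]_(s in `[0, x]) (f s - g s)| <= dK f g.
Proof. by move=> Lf Lg x01; apply: ub_le_sup; [exact: dK_set_ubound|exists x]. Qed.

Lemma dK_le f g (M : R) :
  (forall x, x \in `[0, 1] -> `|\int[leb]_(s in `[0, x]) (f s - g s)| <= M) ->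
  dK f g <= M.
Proof.
move=> H; apply: ge_sup; last by move=> _ [x x01 <-]; exact: H.
exists `|\int[leb]_(s in `[0, (0:R)]) (f s - g s)|; exists 0 => //.
by rewrite /= in_itv/= lexx ler01.
Qed.

Lemma RintegralB_Linfty f g x : Linfty f -> Linfty g -> x \in `[0, 1] ->
  \int[leb]_(s in `[0, x]) (f s - g s) =
  \int[leb]_(s in `[0, x]) f s - \int[leb]_(s in `[0, x]) g s.
Proof.
move=> Lf Lg x01; apply: RintegralB; first exact: leb_measurable.
- exact: Linfty_integrable.
- exact: Linfty_integrable.
Qed.

Lemma dK_ge0 f g : Linfty f -> Linfty g -> 0 <= dK f g.
Proof.
move=> Lf Lg; apply: le_trans (le_dK Lf Lg (x := 0) _) => //.
by rewrite in_itv/= lexx ler01.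
Qed.

Lemma dKC f g : Linfty f -> Linfty g -> dK f g = dK g f.
Proof.
move=> Lf Lg; congr (sup _); apply/seteqP; split=> _ [x x01 <-]; exists x => //;
  by rewrite !RintegralB_Linfty// distrC.
Qed.

Lemma dK_triangle f g h : Linfty f -> Linfty g -> Linfty h ->
  dK f h <= dK f g + dK g h.
Proof.
move=> Lf Lg Lh; apply: dK_le => x x01.
have := le_dK Lf Lg x01; have := le_dK Lg Lh x01.
rewrite !RintegralB_Linfty// => gh fg.
by rewrite (le_trans (ler_distD _ _ _) (lerD fg gh)).
Qed.

(** A constant function has no mode, whatever the partition; so the [inf] in [s_] runs over a
    nonempty set for every [j]. *)
Lemma Xn_neq0 n j : (0 < n)%N -> Xn n j (step (fun _ : 'I_n => 0 : R)).
Proof.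
move=> n0; split; first exact: step_PC.
have s0 t : step (fun _ : 'I_n => 0 : R) t = 0.
  by rewrite /step /cellval; case: insub => [?|]; case: insub => [?|] /=; rewrite addr0 mul0r.
apply: ge_ereal_sup => _ [s _ <-]; rewrite lee_fin ler_nat.
rewrite /modes_on (eq_count (a2 := pred0)) ?count_pred0// => i /=.
by rewrite !s0 maxxx ltxx.
Qed.

Lemma Xn_Linfty n j h : Xn n j h -> Linfty h.
Proof. by move=> [[[]]]. Qed.

Lemma s_le_dK n j f h : Linfty f -> Xn n j h -> s_ n j f <= dK f h.
Proof.
move=> Lf Xh; apply: ge_inf; last by exists h.
by exists 0 => _ [g /Xn_Linfty Lg <-]; exact: dK_ge0.
Qed.

(** Both infima run over the same set [Xn n j]: take the infimum over [h] in the triangle inequality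
    d(f,h) <= d(f,g) + d(g,h), then exchange [f] and [g]. *)
Lemma s_lipschitz n j f g : (0 < n)%N -> Linfty f -> Linfty g ->
  `|s_ n j f - s_ n j g| <= dK f g.
Proof.
move=> n0.
have H f' g' : Linfty f' -> Linfty g' -> s_ n j f' - s_ n j g' <= dK f' g'.
  move=> Lf Lg; rewrite lerBlDl -lerBlDr.
  apply: lb_le_inf.
    exists (dK g' (step (fun _ : 'I_n => 0 : R))).
    by exists (step (fun _ : 'I_n => 0 : R)) => //; exact: Xn_neq0.
  move=> _ [h Xh <-]; rewrite lerBlDr addrC.
  have Lh := Xn_Linfty Xh.
  exact: le_trans (s_le_dK Lf Xh) (dK_triangle Lf Lg Lh).
move=> Lf Lg; rewrite ler_norml H// andbT lerNl opprB dKC//.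
exact: H.
Qed.

End kolmogorov.

(** * Step functions: the distance in terms of partial sums of cell values *)

Section step_distance.
Context (R : realType) (n : nat).
Hypothesis n0 : (0 < n)%N.
Notation leb := (@completed_lebesgue_measure R).
Implicit Types (y z u : 'I_n -> R) (x a b : R).

Lemma step_sub y z t : step y t - step z t = step (fun i => y i - z i) t.
Proof.
rewrite /step /cellval -mulrBl opprD addrACA; congr ((_ + _) / _).
  by case: insub => //=; rewrite subrr.
by case: insub => //=; rewrite subrr.
Qed.

(** At a grid point [step u] need not take the value of the cell. The left end is left out of the
    interval, and the right end [b], possibly a grid point, is split off as a null set. *)
Lemma Rintegral_step_cell u k b : (k < n)%N ->
  k%:R / n%:R <= b <= k.+1%:R / n%:R ->
  \int[leb]_(s in `]k%:R / n%:R, b]) step u s = cellval u k * (b - k%:R / n%:R).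
Proof.
move=> kn /andP[kb bk]; set a := k%:R / n%:R in kb *.
have n0' : 0 < n%:R :> R by rewrite ltr0n.
have a0 : 0 <= a by rewrite divr_ge0.
have b1 : b <= 1 by rewrite (le_trans bk)// ler_pdivrMr// mul1r ler_nat.
have mo : measurable (`]a, b[%classic : set (caratheodory_type (@wlength R idfun)^*%mu)).
  exact: leb_measurable.
have mc : measurable (`[b, b]%classic : set (caratheodory_type (@wlength R idfun)^*%mu)).
  exact: leb_measurable.
have fine_itv (i : interval R) : fine (leb [set` i]) =
    fine (if i.1 < i.2 then (i.2 : \bar R) - i.1 else 0)%E.
  by rewrite -leb_itv.
have [ab|ab] := ltP a b; last first.
  have -> : b - a = 0 by apply: le_anti; lra.
  rewrite mulr0 (_ : `]a, b]%classic = set0) ?Rintegral_set0//.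
  by apply/seteqP; split => // s /=; rewrite in_itv/=; lra.
have -> : `]a, b]%classic = `]a, b[ `|` `[b, b] :> set R.
  apply/seteqP; split=> s /=; rewrite !in_itv/=.
    move=> /andP[as_ sb]; have [sb'|sb'] := ltP s b; first by left; rewrite as_.
    by right; apply/andP.
  by move=> [/andP[p q]|/andP[p q]]; apply/andP; split; lra.
have b01 : b \in `[0, 1] by rewrite in_itv/=; apply/andP; split; lra.
rewrite Rintegral_setU//; last 2 first.
- apply: integrableS (Linfty_integrable (step_Linfty u) b01).
  + exact: leb_measurable.
  + exact: measurableU.
  + move=> s [] /=; rewrite !in_itv/= => /andP[p q]; apply/andP; split; lra.
- by apply/disj_setPS => s [] /=; rewrite !in_itv/= => /andP[p q] /andP[r z]; lra.
rewrite [X in X + _](@eq_Rintegral _ _ _ _ _ (cst (cellval u k))); last first.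
  move=> s; rewrite inE/= in_itv/= => /andP[p q].
  by apply: step_cell => //; rewrite p (lt_le_trans q).
rewrite [X in _ + X](@eq_Rintegral _ _ _ _ _ (cst (step u b))); last first.
  by move=> s; rewrite inE/= in_itv/= => /andP[p q]; congr (step u); lra.
rewrite !Rintegral_cst// !fine_itv /= !lte_fin ltxx mulr0 addr0 ab.
by [].
Qed.

Lemma Rintegral_step_split u k x : (k < n)%N ->
  k%:R / n%:R <= x <= k.+1%:R / n%:R ->
  \int[leb]_(s in `[0, x]) step u s =
  \int[leb]_(s in `[0, k%:R / n%:R]) step u s + cellval u k * (x - k%:R / n%:R).
Proof.
move=> kn kxk; rewrite -(Rintegral_step_cell u kn kxk).
case/andP: kxk => kx xk.
have n0' : 0 < n%:R :> R by rewrite ltr0n.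
have a0 : 0 <= k%:R / n%:R :> R by rewrite divr_ge0.
have x1 : x <= 1 by rewrite (le_trans xk)// ler_pdivrMr// mul1r ler_nat.
have E : `[0, x]%classic = `[0, k%:R / n%:R] `|` `]k%:R / n%:R, x] :> set R.
  apply/seteqP; split=> s /=; rewrite !in_itv/=.
    move=> /andP[as_ sb]; have [sb'|sb'] := leP s (k%:R / n%:R).
      by left; rewrite as_.
    by right; rewrite sb.
  by move=> [/andP[p q]|/andP[p q]]; apply/andP; split; lra.
rewrite [in LHS]E Rintegral_setU//.
- exact: leb_measurable.
- exact: leb_measurable.
- rewrite -E; apply: Linfty_integrable; first exact: step_Linfty.
  by rewrite in_itv/=; apply/andP; split; lra.
- by apply/disj_setPS => s [] /=; rewrite !in_itv/= => /andP[p q] /andP[r z]; lra.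
Qed.

Lemma Rintegral_step_grid u k : (k <= n)%N ->
  \int[leb]_(s in `[0, k%:R / n%:R]) step u s = (\sum_(i < k) cellval u i) / n%:R.
Proof.
have n0' : 0 < n%:R :> R by rewrite ltr0n.
elim: k => [_|k IH kn].
  rewrite mul0r big_ord0 mul0r.
  rewrite (@step_integral _ _ u 0 0 0 0 0)// ?mul0r ?addr0// => s /andP[]; lra.
rewrite (@Rintegral_step_split u k)//; last first.
  by rewrite lexx andbT ler_pM2r ?invr_gt0// ler_nat.
rewrite IH 1?ltnW// big_ord_recr /= mulrDl; congr (_ + _).
by rewrite -mulrBl -natrB// subSnn mul1r.
Qed.

(** The primitive of a step function is affine on each cell, so its absolute value is largest at a
    grid point k/n, where it is a partial sum divided by [n]. *)
Lemma dK_step_le y z (M : R) :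
  (forall k, (k <= n)%N ->
    `|\sum_(i < k) cellval (fun i => y i - z i) i| <= M * n%:R) ->
  dK (step y) (step z) <= M.
Proof.
move=> HM; have n0' : 0 < n%:R :> R by rewrite ltr0n.
apply: dK_le => x; rewrite in_itv/= => /andP[x0 x1].
set u := fun i => y i - z i in HM *.
rewrite (_ : Rintegral _ _ _ = \int[leb]_(s in `[0, x]) step u s); last first.
  by apply: eq_Rintegral => s _; exact: step_sub.
(* At x = 1 the truncation below would give [n], which is not the index of a cell. *)
have [->|xn1] := eqVneq x 1.
  rewrite -(@divff _ n%:R) ?gt_eqF// Rintegral_step_grid// normrM normfV.
  by rewrite (ger0_norm (ltW n0')) ler_pdivrMr// HM.
have xlt : x < 1 by rewrite lt_neqAle xn1.
pose k := Num.truncn (x * n%:R).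
have xn0 : 0 <= x * n%:R by rewrite mulr_ge0.
have kn : (k < n)%N by rewrite truncn_lt_nat// gtr_pMl.
have kx : k%:R <= x * n%:R by rewrite truncn_le.
have xk : x * n%:R < k.+1%:R by exact: truncnS_gt.
rewrite (@Rintegral_step_split u k)//; last first.
  by rewrite ler_pdivrMr// ler_pdivlMr// kx ltW.
rewrite Rintegral_step_grid 1?ltnW//.
have := HM k (ltnW kn); have := HM k.+1 kn; rewrite big_ord_recr /=.
set S := \sum_(i < k) _; set c := cellval u k.
rewrite -natr1 in xk.
move=> H1 H2.
(* The numerator is a convex combination of the consecutive partial sums S and S + c, with weight x
   n - k in [0,1] on the latter. *)
rewrite (_ : _ + _ = (S + c * (x * n%:R - k%:R)) / n%:R); last first.
  by field; rewrite gt_eqF.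
rewrite normrM normfV (ger0_norm (ltW n0')) ler_pdivrMr//.
move: H1 H2; rewrite !ler_norml => /andP[H1 H2] /andP[H3 H4].
by apply/andP; split; nra.
Qed.

End step_distance.

(** * Measurability of events defined by Lipschitz functionals *)

Section lipschitz_event.
Context d (T : measurableType d) (R : realType) (n : nat).

(* The measure of a nonmeasurable set is a junk value, so the event of the
   theorem has to be shown measurable. Being Lipschitz, G is the infimum over
   rational points q of the measurable functions G q + \sum_i |y i - q i|. *)
Lemma measurable_lipschitz_ge (G : ('I_n -> R) -> R) (Y : 'I_n -> T -> R) (c : R) :
  (forall y z, G y <= G z + \sum_i `|y i - z i|) ->
  (forall i, measurable_fun setT (Y i)) ->
  measurable [set w | c <= G (Y^~ w)].
Proof.
move=> GL mY.
pose E (q : {ffun 'I_n -> rat}) :=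
  [set w | c <= G (fun i => ratr (q i)) + \sum_i `|Y i w - ratr (q i)|].
have -> : [set w | c <= G (Y^~ w)] =
    \bigcap_k (if unpickle k is Some q then E q else setT).
  apply/seteqP; split => [w /= cG k _|w /= H].
    by case: unpickle => // q; exact: le_trans cG (GL _ _).
  rewrite leNgt; apply/negP => Gc.
  pose g := c - G (Y^~ w); have g0 : 0 < g by rewrite subr_gt0.
  (* The approximation error counts twice, in [E q] and through [GL], so its sum over [i] must stay
     below g/2; [n.+1] keeps the divisor nonzero. *)
  pose r := g / (2 * n.+1%:R); have r0 : 0 < r by rewrite divr_gt0// mulr_gt0.
  have Q i : {q : rat | `|Y i w - ratr q| < r}.
    apply/cid; have : Y i w - r < Y i w + r by lra.
    move=> /rat_in_itvoo[q]; rewrite in_itv/= => /andP[q1 q2].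
    by exists q; rewrite ltr_norml; apply/andP; split; lra.
  pose q := [ffun i => sval (Q i)].
  have := H (pickle q) I; rewrite pickleK /E /=.
  have D : \sum_i `|Y i w - ratr (q i)| <= n%:R * r.
    rewrite mulr_natl -[in leRHS](card_ord n) -sumr_const; apply: ler_sum => i _.
    by rewrite ffunE ltW//; case: (Q i).
  have Gq := GL (fun i => ratr (q i)) (Y^~ w).
  have nr : n%:R * r < g / 2.
    have : r * (2 * n.+1%:R) = g by rewrite divfK// mulf_neq0.
    by rewrite -natr1 => <-; rewrite ltr_pdivlMr//; set N := n%:R; nra.
  rewrite (eq_bigr (fun i => `|Y i w - ratr (q i)|)) in Gq; last first.
    by move=> i _; rewrite distrC.
  rewrite /g in nr; lra.
apply: bigcapT_measurable => k; case: unpickle => // q.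
rewrite -[X in measurable X]setTI; apply: measurable_fun_ler => //.
apply: measurable_funD => //; apply: measurable_sum => i.
by apply: measurableT_comp => //; exact: measurable_funB.
Qed.

End lipschitz_event.

(** * The statistic of the theorem as a function of the cell values *)

Section sup_distance.
Context (R : realType) (n : nat).
Hypothesis n0 : (0 < n)%N.
Implicit Types y z : 'I_n -> R.

Definition max_s_dist z y : R :=
  sup [set `|s_ n j (step y) - s_ n j (step z)| | j in [set: nat]].

Lemma max_s_dist_le z y : max_s_dist z y <= dK (step y) (step z).
Proof.
apply: ge_sup; first by exists `|s_ n 0 (step y) - s_ n 0 (step z)|; exists 0%N.
by move=> _ [j _ <-]; apply: s_lipschitz => //; exact: step_Linfty.
Qed.

(** Serves the measurability of the event only, so the factor 1/n available from [dK_step_le] is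
    given away. *)
Lemma max_s_dist_lipschitz z y y' :
  max_s_dist z y <= max_s_dist z y' + \sum_i `|y i - y' i|.
Proof.
apply: ge_sup; first by exists `|s_ n 0 (step y) - s_ n 0 (step z)|; exists 0%N.
move=> _ [j _ <-]; rewrite [leRHS]addrC.
apply: le_trans (ler_distD (s_ n j (step y')) _ _) _; apply: lerD; last first.
  apply: ub_le_sup; last by exists j.
  (* The Lipschitz bound is uniform in [j], so the supremum is over a bounded set. *)
  exists (dK (step y') (step z)) => _ [k _ <-].
  by apply: s_lipschitz => //; exact: step_Linfty.
apply: le_trans (s_lipschitz j n0 (step_Linfty y) (step_Linfty y')) _.
apply: (dK_step_le n0) => k kn.
apply: (@le_trans _ _ (\sum_i `|y i - y' i|)); last first.
  by rewrite ler_peMr ?sumr_ge0// ler1n.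
apply: le_trans (ler_norm_sum _ _ _) _.
rewrite (big_ord_widen n (fun i => `|cellval (fun i => y i - y' i) i|))//.
rewrite [leRHS](bigID (fun i : 'I_n => (i < k)%N))/=.
rewrite -[leLHS]addr0; apply: lerD; last by rewrite sumr_ge0.
by apply: ler_sum => i _; rewrite /cellval valK.
Qed.

(** Otherwise the finitely many partial sums all lie strictly below M n in absolute value. So does
    their maximum [m], and the distance is at most m/n < M. *)
Lemma max_s_dist_ge z y (M : R) : 0 < M -> M <= max_s_dist z y ->
  exists2 k, (k <= n)%N & M * n%:R <= `|\sum_(i < k) cellval (fun i => y i - z i) i|.
Proof.
move=> M0 MG; apply: contrapT => H.
have n0' : 0 < n%:R :> R by rewrite ltr0n.
pose S k := `|\sum_(i < k) cellval (fun i => y i - z i) i|.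
have SM k : (k <= n)%N -> S k < M * n%:R.
  by move=> kn; rewrite ltNge; apply/negP => ?; apply: H; exists k.
pose m := \big[Num.max/0]_(k < n.+1) S k.
have mM : m < M * n%:R.
  by apply: bigmax_lt => [|k _]; [rewrite mulr_gt0|rewrite SM// -ltnS].
have : dK (step y) (step z) <= m / n%:R.
  apply: (dK_step_le n0) => k kn; rewrite divfK ?gt_eqF//.
  exact: (@le_bigmax _ _ _ 0 (fun k : 'I_n.+1 => S k) (Ordinal (kn : (k < n.+1)%N))).
rewrite leNgt => /negP; apply; rewrite ltr_pdivrMr// (lt_le_trans mM)//.
by rewrite ler_pM2r// (le_trans MG)// max_s_dist_le.
Qed.

End sup_distance.

(** * Bernstein's bound on the moment generating function *)

Section bernstein_mgf.
Context (R : realType).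

(** The linear term stays signed, so that it vanishes in expectation for a centred variable;
    absolute values from order two on allow termwise integration. *)
Lemma expR_le_taylor1 (u : R) :
  ((expR u)%:E <= (1 + u)%:E
     + \sum_(0 <= m <oo) (`|u| ^+ m.+2 / m.+2`!%:R)%:E)%E.
Proof.
set S := (\sum_(0 <= m <oo) _)%E.
have u0 (m : nat) : (0 <= (`|u| ^+ m.+2 / m.+2`!%:R)%:E)%E.
  by rewrite lee_fin divr_ge0// exprn_ge0.
have SN N : (\sum_(0 <= m < N) (`|u| ^+ m.+2 / m.+2`!%:R)%:E <= S)%E.
  exact: nneseries_lim_ge.
(* An infinite sum makes the bound trivial; otherwise partial sums are compared in [R]. *)
have [Sfin|] := boolP (S \is a fin_num); last first.
  rewrite ge0_fin_numE ?nneseries_ge0// -leNgt leye_eq => /eqP ->.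
  by rewrite addey// leey.
rewrite -(fineK Sfin) -EFinD lee_fin.
apply: limr_le; first exact: is_cvg_series_exp_coeff.
near=> N.
have [M ->] : exists M, N = M.+2.
  by exists N.-2; rewrite !prednK//; near: N; exists 2%N => // -[|[|]].
rewrite /series /= big_nat_recl// big_nat_recl// /exp_coeff /=.
rewrite expr0 expr1 fact0 !divr1 addrA lerD2l.
rewrite -lee_fin fineK// (le_trans _ (SN M))// sumEFin lee_fin.
apply: ler_sum => m _; rewrite ler_pM2r ?invr_gt0 ?ltr0n ?fact_gt0//.
by rewrite -normrX ler_norm.
Unshelve. all: by end_near. Qed.

Lemma nneseries_geometric_le (a r : R) : 0 <= a -> 0 <= r < 1 ->
  (\sum_(0 <= m <oo) (a * r ^+ m)%:E <= (a / (1 - r))%:E)%E.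
Proof.
move=> a0 /andP[r0 r1].
apply: lime_le.
  by apply: is_cvg_nneseries => m _ _; rewrite lee_fin mulr_ge0// exprn_ge0.
apply: nearW => N; rewrite sumEFin lee_fin.
have := @geometric_seriesE _ a r _; rewrite lt_eqF// => /(_ isT)/(congr1 (@^~ N)).
rewrite /series /geometric /= => ->.
rewrite ler_pM2r ?invr_gt0 ?subr_gt0//.
by rewrite ler_piMr// gerBl exprn_ge0.
Qed.

Context d (T : measurableType d) (P : probability T R).

(** By the moment hypothesis the Taylor term of order m + 2 has expectation at most a r^m with a = v
    l^2 / 2 and r = kappa |l| < 1. The geometric series gives 1 + a / (1 - r), and 1 + x <= exp x
    concludes. *)
Lemma bernstein_mgf (X : {RV P >-> R}) (kappa v l : R) :
  0 < kappa -> 0 < v -> kappa * `|l| < 1 -> ('E_P[X] = 0)%E ->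
  (forall m, (2 <= m)%N -> ('E_P[(fun w => `|X w| ^+ m)%R]
     <= (v * (m`!)%:R * kappa ^+ (m - 2) / 2)%:E)%E) ->
  (\int[P]_w (expR (l * X w))%:E
     <= (expR (v * l ^+ 2 / (2 * (1 - kappa * `|l|))))%:E)%E.
Proof.
move=> k0 v0 kl EX0 mom.
have mX : measurable_fun setT X by [].
have mXm m : measurable_fun setT (fun w => `|X w| ^+ m).
  by apply: measurable_funX; exact: measurableT_comp.
(* Integrability comes from the second moment, through |x| <= 1 + x^2. *)
have iX : P.-integrable setT (EFin \o X).
  apply: (@le_integrable _ _ _ P setT measurableT _
    (fun w => 1 + (`|X w| ^+ 2)%:E)%E) => //.
  - exact/measurable_EFinP.
  - move=> w _ /=; rewrite lee_fin [leRHS]ger0_norm ?addr_ge0//.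
    have := sqr_ge0 (`|X w| - 1); have := normr_ge0 (X w).
    by rewrite !expr2; nra.
  - apply: integrableD => //.
      exact: finite_measure_integrable_cst.
    apply/integrableP; split; first exact/measurable_EFinP.
    have := mom 2 isT; rewrite unlock => /le_lt_trans -/(_ _ (ltry _)).
    by rewrite (eq_integral (fun w => (`|X w| ^+ 2)%:E))// => w _; rewrite gee0_abs.
have ilX : P.-integrable setT (fun w => (l * X w)%:E).
  by have := integrableZl measurableT l iX.
have EX : (\int[P]_w (1 + l * X w)%:E = 1)%E.
  under eq_integral do rewrite EFinD.
  rewrite integralD//; last exact: finite_measure_integrable_cst.
  rewrite integral_cst// mul1e.
  under [X in (_ + X)%E]eq_integral do rewrite EFinM.
  rewrite integralZl//.
  move: EX0; rewrite unlock => ->; rewrite mule0 adde0; exact: probability_setT.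
pose r := kappa * `|l|; pose a := v * l ^+ 2 / 2.
have a0 : 0 <= a by rewrite divr_ge0// mulr_ge0 ?sqr_ge0// ltW.
have r01 : 0 <= r < 1 by rewrite /r kl andbT mulr_ge0// ltW.
pose f m w := ((`|l * X w| ^+ m.+2 / m.+2`!%:R)%:E : \bar R).
have f0 m w : (0 <= f m w)%E by rewrite lee_fin divr_ge0// exprn_ge0.
have mf m : measurable_fun setT (f m).
  apply/measurable_EFinP; apply: measurable_funM => //.
  apply: measurable_funX; apply: measurableT_comp => //.
  exact: measurable_funM.
have Ef m : (\int[P]_w f m w <= (a * r ^+ m)%:E)%E.
  have c0 : 0 <= `|l| ^+ m.+2 / m.+2`!%:R by rewrite divr_ge0// exprn_ge0.
  rewrite (eq_integral (fun w => (`|l| ^+ m.+2 / m.+2`!%:R)%:E * (`|X w| ^+ m.+2)%:E)%E).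
    rewrite ge0_integralZl//; last exact/measurable_EFinP.
    have := mom m.+2 isT; rewrite unlock => Em.
    apply: (le_trans (lee_wpmul2l _ Em)); first by rewrite lee_fin.
    rewrite -EFinM lee_fin /a /r subn2 /= exprMn -[l ^+ 2]real_normK ?num_real//.
    rewrite le_eqVlt; apply/orP; left; apply/eqP.
    rewrite !exprS; field.
    by rewrite ?pnatr_eq0 -?lt0n ?fact_gt0.
  by move=> w _; rewrite -EFinM /f normrM exprMn mulrAC.
have intS : (\int[P]_w \sum_(0 <= m <oo) f m w <= (a / (1 - r))%:E)%E.
  rewrite integral_nneseries//.
  apply: le_trans (nneseries_geometric_le a0 r01).
  by apply: (@lee_nneseries _ _ _ xpredT) => m *; [exact: integral_ge0|exact: Ef].
have mS : measurable_fun setT (fun w => \sum_(0 <= m <oo) f m w)%E.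
  exact: ge0_emeasurable_sum.
apply: (@le_trans _ _ (\int[P]_w ((1 + l * X w)%:E + \sum_(0 <= m <oo) f m w))%E).
  apply: ge0_le_integral => //.
  - apply/measurable_EFinP; apply: measurableT_comp => //.
    exact: measurable_funM.
  - apply: emeasurable_funD => //.
    by apply/measurable_EFinP; apply: measurable_funD => //; exact: measurable_funM.
  - by move=> w _; exact: expR_le_taylor1.
rewrite integralD//; last 2 first.
- under eq_fun do rewrite EFinD.
  by apply: integrableD => //; exact: finite_measure_integrable_cst.
- apply/integrableP; split => //.
  rewrite (eq_integral (fun w => \sum_(0 <= m <oo) f m w)%E).
    exact: le_lt_trans intS (ltry _).
  by move=> w _; rewrite gee0_abs//; exact: nneseries_ge0.
rewrite EX (le_trans (leeD2l _ intS))// -EFinD lee_fin.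
apply: le_trans (expR_ge1Dx _).
by rewrite lerD2l /a /r -[leLHS]mulrA -invfM.
Qed.

End bernstein_mgf.

(** * The sigma-algebra of the past and its independence of the next error *)

Section past.
Context d (T : measurableType d) (R : realType) (P : probability T R).
Context n (e : 'I_n -> {RV P >-> R}).

(* A pi-system generating the sigma-algebra of the variables e i with i < m. *)
Definition past (m : nat) : set (set T) :=
  [set A | exists2 B : 'I_n -> set R, (forall i, measurable (B i)) &
    A = \bigcap_(i in [set` [set i : 'I_n | (i < m)%N]%SET]) (e i @^-1` B i)].

Lemma past_generator_measurable m : past m `<=` measurable.
Proof.
move=> _ [B mB ->]; apply: fin_bigcap_measurable => [//|i _].
by rewrite -[X in measurable X]setTI; exact: measurable_funPT.
Qed.

Lemma past_setI_closed m : setI_closed (past m).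
Proof.
move=> _ _ [B mB ->] [C mC ->].
exists (fun i => B i `&` C i) => [i|]; first exact: measurableI.
by rewrite -bigcapI; apply: eq_bigcapr => i _; rewrite preimage_setI.
Qed.

Lemma past_preimage m (i : 'I_n) (C : set R) : (i < m)%N -> measurable C ->
  past m (e i @^-1` C).
Proof.
move=> im mC; exists (fun j => if j == i then C else setT) => [j|].
  by case: ifP.
apply/seteqP; split => [w Cw j _|w /(_ i)] /=.
  by case: eqVneq => [->|].
by rewrite eqxx inE; apply.
Qed.

Lemma measurable_past m (i : 'I_n) : (i < m)%N ->
  measurable_fun setT (e i : g_sigma_algebraType (past m) -> R).
Proof.
move=> im _ C mC; rewrite setTI.
by apply: sub_sigma_algebra; exact: past_preimage.
Qed.

Lemma sub_past m : <<s past m >> `<=` measurable.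
Proof.
apply: smallest_sub; first exact: sigma_algebra_measurable.
exact: past_generator_measurable.
Qed.

Lemma past_measurable_fun m d' (T' : measurableType d') (X : T -> T') :
  measurable_fun setT (X : g_sigma_algebraType (past m) -> T') ->
  measurable_fun setT X.
Proof.
move=> mX _ A mA; rewrite setTI; apply: sub_past.
by rewrite -[X in (<<s _ >>) X]setTI; exact: mX.
Qed.

Hypothesis indep : mutually_independent e.

(** As functions of [A], both sides are finite measures: a restriction of [P] and a multiple of [P].
    They agree on the pi-system [past i], hence on the sigma-algebra it generates. *)
Lemma past_independent (i : 'I_n) (A : set T) (C : set R) : measurable C ->
  <<s past i >> A -> (P (A `&` e i @^-1` C) = P A * P (e i @^-1` C))%E.
Proof.
move=> mC sA.
have mD : measurable (e i @^-1` C).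
  by rewrite -[X in measurable X]setTI; exact: measurable_funPT.
have p0 : 0 <= fine (P (e i @^-1` C)) by rewrite fine_ge0.
have pE : P (e i @^-1` C) = (fine (P (e i @^-1` C)))%:E.
  by rewrite fineK// fin_num_measure.
rewrite muleC [in RHS]pE.
apply: (@g_sigma_algebra_measure_unique _ _ _ (past i) (@past_generator_measurable i)
  (fun=> setT) _ _ (mrestr P mD) (mscale (NngNum p0) P)) => //.
- move=> _; exists (fun=> setT) => //.
  by apply/seteqP; split.
- by rewrite bigcup_const.
- exact: past_setI_closed.
- move=> _ [B mB ->].
  rewrite -[RHS]/((fine (P (e i @^-1` C)))%:E * _)%E -pE /mrestr.
  pose J : {set 'I_n} := [set j : 'I_n | (j < i)%N]%SET.
  (* Replacing the condition at [i] by [C] lets independence be applied to [J] together with [i]; a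
     second application, to [J] alone, recovers the factor for the past. *)
  pose B' j := if j == i then C else B j.
  have mB' j : measurable (B' j) by rewrite /B'; case: ifP.
  have iJ : i \notin J by rewrite inE ltnn.
  have B'J j : j \in J -> B' j = B j.
    by move=> jJ; rewrite /B'; case: eqP => // ji; rewrite -ji jJ in iJ.
  have := indep (i |: J)%SET mB'; rewrite big_setU1//=.
  rewrite (_ : B' i = C) => [H|]; last by rewrite /B' eqxx.
  transitivity (P (\bigcap_(j in [set` (i |: J)%SET]) (e j @^-1` B' j))).
    congr (P _); apply/seteqP; split => w.
      move=> [JB iC] j /=; rewrite !inE => /orP[/eqP ->|jJ].
        by rewrite /B' eqxx.
      by rewrite B'J ?inE//; apply: JB; rewrite /= inE.
    move=> H'; split.
      by move=> j /= jJ; rewrite -[B j]B'J//; apply: H'; rewrite /= inE jJ orbT.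
    by have := H' i; rewrite /B' /= eqxx; apply; rewrite !inE eqxx.
  rewrite H; congr (_ * _)%E.
  by rewrite (indep J mB); apply: eq_bigr => j jJ; rewrite B'J.
- by move=> _; rewrite -ge0_fin_numE ?fin_num_measure.
Qed.

End past.

(** * Product formula for expectations of nonnegative independent variables *)

Section independence.
Context d (T : measurableType d) (R : realType) (P : probability T R).

(** Agreement on rectangles identifies the joint law with the product of the two laws; Tonelli then
    separates the integrals. *)
Lemma expectationM_independent (X Y : {RV P >-> R}) :
  (forall w, 0 <= X w) -> (forall w, 0 <= Y w) ->
  (forall A B, measurable A -> measurable B ->
    P (X @^-1` A `&` Y @^-1` B) = P (X @^-1` A) * P (Y @^-1` B))%E ->
  (\int[P]_w (X w * Y w)%:E =
   \int[P]_w (X w)%:E * \int[P]_w (Y w)%:E)%E.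
Proof.
move=> X0 Y0 XY.
pose Z w := (X w, Y w).
have mZ : measurable_fun setT Z.
  by apply/measurable_fun_pairP; split => //=; exact: measurable_funPT.
pose Z' : {mfun T >-> (R * R)%type} :=
  HB.pack Z (isMeasurableFun.Build _ _ _ _ Z mZ).
(* The absolute values make the integrand nonnegative on the whole plane, as Tonelli requires; they
   do not change it along (X, Y). *)
pose h (p : R * R) : \bar R := (`|p.1| * `|p.2|)%:E.
have h0 p : (0 <= h p)%E by rewrite lee_fin mulr_ge0.
have mh : measurable_fun setT h.
  by apply/measurable_EFinP; apply: measurable_funM; apply: measurableT_comp.
have lawZ A : measurable A ->
    (distribution P X \x distribution P Y)%E A = distribution P Z' A.
  move=> mA; apply: (@product_measure_unique _ _ _ _ R (distribution P X)
    (distribution P Y) (distribution P Z') _ A mA) => B C mB mC.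
  by rewrite -XY.
have -> : (\int[P]_w (X w * Y w)%:E = \int[distribution P Z']_p h p)%E.
  rewrite ge0_integral_distribution//; apply: eq_integral => w _.
  by rewrite /h /= !ger0_norm.
transitivity (\int[distribution P X \x distribution P Y]_p h p)%E.
  by apply: eq_measure_integral => A mA _; exact/esym/lawZ.
rewrite fubini_tonelli1//= /fubini_F/=.
have mn : measurable_fun setT (fun y : R => `|y|%:E).
  by apply/measurable_EFinP; exact: normr_measurable.
transitivity (\int[distribution P X]_x (`|x|%:E * \int[distribution P Y]_y `|y|%:E))%E.
  by apply: eq_integral => x _; rewrite -ge0_integralZl.
rewrite ge0_integralZr//; last by apply: integral_ge0 => y _; rewrite lee_fin.
rewrite !ge0_integral_distribution//.
by congr (_ * _)%E; apply: eq_integral => w _ /=; rewrite ger0_norm.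
Qed.

End independence.

(** * Maximal inequality by stopping the exponential process *)

Section maximal.
Context (R : realType).
Implicit Types (c l : R) (x : nat -> R).

(* exp(l S_k) for the partial sums S_k of x, frozen once it has reached c. *)
Fixpoint stopped_exp c l x k : R :=
  if k is k'.+1 then
    let z := stopped_exp c l x k' in if c <= z then z else z * expR (l * x k')
  else 1.

Lemma stopped_exp_gt0 c l x k : 0 < stopped_exp c l x k.
Proof. by elim: k => //= k IH; case: ifP => // _; rewrite mulr_gt0 ?expR_gt0. Qed.

Lemma le_stopped_exp c l x m k : (k <= m)%N ->
  c <= expR (l * \sum_(i < k) x i) -> c <= stopped_exp c l x m.
Proof.
(* Invariant by induction on [m]: either the process has reached [c] and is frozen, or it still
   equals the exponential and no index up to [m] has reached [c]. *)
have H : c <= stopped_exp c l x m \/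
    (stopped_exp c l x m = expR (l * \sum_(i < m) x i) /\
    forall k, (k <= m)%N -> expR (l * \sum_(i < k) x i) < c).
  elim: m => [|m IH] /=.
    rewrite big_ord0 mulr0 expR0; have [|c1] := leP c 1; first by left.
    by right; split => // j; rewrite leqn0 => /eqP ->; rewrite big_ord0 mulr0 expR0.
  have [|zc] := leP c (stopped_exp c l x m); first by left.
  case: IH => [|[zE IH]]; first by rewrite leNgt zc.
  rewrite zE -expRD -mulrDr.
  rewrite (_ : _ + x m = \sum_(i < m.+1) x i); last by rewrite big_ord_recr.
  have [|sc] := leP c (expR (l * \sum_(i < m.+1) x i)); first by left.
  right; split => // j; rewrite leq_eqVlt => /predU1P[->//|]; exact: IH.
case: H => // -[_ H] km ck.
by have := H _ km; rewrite ltNge ck.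
Qed.

Context d (T : measurableType d) (P : probability T R).
Context n (e : 'I_n -> {RV P >-> R}) (indep : mutually_independent e).
(** [cellval] continues the errors by zero from index [n] on, so that partial sums are indexed by
    natural numbers. *)
Let x w := cellval (fun i => e i w).

(** The value at time [k] involves only errors of index below [k]. Measurability for this smaller
    sigma-algebra is what makes it independent of the error of index [k]. *)
Lemma measurable_stopped_exp c l k : (k <= n)%N ->
  measurable_fun setT
    ((fun w => stopped_exp c l (x w) k) : g_sigma_algebraType (past e k) -> R).
Proof.
move=> kn.
have : forall j, (j <= k)%N -> measurable_fun setT
    ((fun w => stopped_exp c l (x w) j) : g_sigma_algebraType (past e k) -> R).
  elim=> [|j IH] jk /=; first exact: measurable_cst.
  have {}IH := IH (ltnW jk).
  have jn : (j < n)%N := leq_trans jk kn.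
  apply: measurable_fun_if => //.
  - by apply: measurable_fun_ler => //; exact: measurable_cst.
  - exact: measurable_funS IH.
  - apply: measurable_funM; first exact: measurable_funS IH.
    apply: measurableT_comp; first exact: measurable_expR.
    apply: measurable_funM; first exact: measurable_cst.
    rewrite /x /cellval insubT/=.
    by apply: measurable_funTS; exact: measurable_past.
by apply.
Qed.

Lemma expectation_stopped_exp c l rho : 1 <= rho ->
  (forall i, \int[P]_w (expR (l * e i w))%:E <= rho%:E)%E ->
  forall k, (k <= n)%N ->
  (\int[P]_w (stopped_exp c l (x w) k)%:E <= (rho ^+ k)%:E)%E.
Proof.
move=> rho1 mgf; elim => [|k IH] kn /=.
  by rewrite integral_cst// mul1e expr0; exact: probability_le1.
pose i := Ordinal kn.
pose Z w := stopped_exp c l (x w) k.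
have Z0 w : 0 <= Z w by rewrite ltW// stopped_exp_gt0.
have mZ := measurable_stopped_exp c l (ltnW kn).
rewrite -/Z in mZ.
(* The increment only multiplies the part V of Z that has not been stopped, and
   V is a function of the past. *)
pose U w := Z w * (c <= Z w)%R%:R.
pose V w := Z w * (Z w < c)%R%:R.
pose Y w := expR (l * e i w).
have mb (b : g_sigma_algebraType (past e k) -> bool) : measurable_fun setT b ->
    measurable_fun setT (fun w => (b w)%:R : R).
  move=> mb; rewrite (_ : (fun _ => _) = (fun w => if b w then 1 else 0)).
    by apply: measurable_fun_if => //; exact: measurable_cst.
  by apply/funext => w; case: (b w).
have mV : measurable_fun setT (V : g_sigma_algebraType (past e k) -> R).
  by apply: measurable_funM => //; apply: mb; exact: measurable_fun_ltr.
have mU : measurable_fun setT (U : g_sigma_algebraType (past e k) -> R).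
  by apply: measurable_funM => //; apply: mb; exact: measurable_fun_ler.
have mV' := past_measurable_fun mV.
have mU' := past_measurable_fun mU.
have mg : measurable_fun setT (fun y : R => expR (l * y)).
  apply: measurableT_comp; first exact: measurable_expR.
  by apply: measurable_funM => //; exact: measurable_cst.
have mY : measurable_fun setT Y by exact: (measurableT_comp mg).
pose V' : {RV P >-> R} := HB.pack V (isMeasurableFun.Build _ _ _ _ V mV').
pose Y' : {RV P >-> R} := HB.pack Y (isMeasurableFun.Build _ _ _ _ Y mY).
have U0 w : 0 <= U w by rewrite mulr_ge0.
have V0 w : 0 <= V w by rewrite mulr_ge0.
have Y0 w : 0 <= Y w by exact: expR_ge0.
have VY : (\int[P]_w (V w * Y w)%:E =
    \int[P]_w (V w)%:E * \int[P]_w (Y w)%:E)%E.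
  apply: (@expectationM_independent _ _ _ P V' Y') => // A B mA mB.
  rewrite [Y' @^-1` B](_ : _ = e i @^-1` ((fun y => expR (l * y)) @^-1` B))//.
  apply: (past_independent indep (i := i)).
    by rewrite -[X in measurable X]setTI; exact: mg.
  by rewrite -[X in (<<s _ >>) X]setTI; exact: mV.
rewrite (_ : (fun w => _) = (fun w => (U w)%:E + (V w * Y w)%:E)%E); last first.
  apply/funext => w; rewrite -EFinD; congr EFin.
  rewrite -/(Z w) /U /V /Y /x /cellval insubT/= -/i.
  by case: (leP c (Z w)) => _; rewrite ?mulr1 ?mulr0 ?mul0r ?add0r ?addr0.
rewrite ge0_integralD//; last 4 first.
- by move=> w _; rewrite lee_fin.
- exact/measurable_EFinP.
- by move=> w _; rewrite lee_fin mulr_ge0.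
- by apply/measurable_EFinP; exact: measurable_funM.
rewrite VY.
apply: (@le_trans _ _ (rho%:E * (\int[P]_w (U w)%:E + \int[P]_w (V w)%:E))%E).
  have UP : (0 <= \int[P]_w (U w)%:E)%E.
    by apply: integral_ge0 => w _; rewrite lee_fin.
  have VP : (0 <= \int[P]_w (V w)%:E)%E.
    by apply: integral_ge0 => w _; rewrite lee_fin.
  rewrite [leRHS]ge0_muleDr//; apply: leeD.
    by rewrite -[leLHS]mul1e; apply: lee_wpmul2r; rewrite ?lee_fin.
  by rewrite muleC; apply: lee_wpmul2r => //; exact: mgf.
rewrite -ge0_integralD//; last 4 first.
- by move=> w _; rewrite lee_fin.
- exact/measurable_EFinP.
- by move=> w _; rewrite lee_fin.
- exact/measurable_EFinP.
rewrite (_ : (fun w => _) = (fun w => (Z w)%:E)); last first.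
  apply/funext => w; rewrite -EFinD; congr EFin; rewrite /U /V.
  by case: (leP c (Z w)) => _; rewrite ?mulr1 ?mulr0 ?add0r ?addr0.
rewrite exprS EFinM; apply: lee_wpmul2l; last exact: IH (ltnW kn).
by rewrite lee_fin (le_trans _ rho1).
Qed.

(** If [c] is the exponential of |l| a, this is max S_k >= a for l > 0 and min S_k <= -a for l < 0;
    one event thus serves both tails. *)
Definition max_exceeds c l : set T :=
  [set w | exists2 k, (k <= n)%N & c <= expR (l * \sum_(i < k) x w i)].

Lemma measurable_max_exceeds c l : measurable (max_exceeds c l).
Proof.
rewrite (_ : max_exceeds c l = \bigcup_(k in [set k | (k <= n)%N])
    [set w | c <= expR (l * \sum_(i < k) x w i)]); last first.
  by apply/seteqP; split => [w [k kn ck]|w [k kn ck]]; exists k.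
apply: bigcup_measurable => k _; rewrite -[X in measurable X]setTI.
apply: measurable_fun_ler => //; apply: measurableT_comp => //.
apply: measurable_funM => //; apply: measurable_sum => i.
by rewrite /x /cellval; case: insubP => [j _ _|_] /=.
Qed.

(** On the event the process is frozen at a value at least [c], so Markov's inequality for the
    single variable at time [n] controls all [k]. *)
Lemma maximal_inequality c l rho : 0 < c -> 1 <= rho ->
  (forall i, \int[P]_w (expR (l * e i w))%:E <= rho%:E)%E ->
  (P (max_exceeds c l) <= (rho ^+ n / c)%:E)%E.
Proof.
move=> c0 rho1 mgf.
pose Z w := stopped_exp c l (x w) n.
have mZ : measurable_fun setT Z.
  exact: past_measurable_fun (measurable_stopped_exp c l (leqnn n)).
pose Z' : {RV P >-> R} := HB.pack Z (isMeasurableFun.Build _ _ _ _ Z mZ).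
rewrite EFinM lee_pdivlMr// muleC.
apply: (@le_trans _ _ (\int[P]_w (Z w)%:E)%E); last first.
  exact: expectation_stopped_exp.
apply: (@le_trans _ _ (c%:E * P [set w | (c%:E <= `|(Z' w)%:E|)%E])%E).
  apply: lee_wpmul2l; first by rewrite lee_fin ltW.
  apply: le_measure; rewrite ?inE; first exact: measurable_max_exceeds.
    rewrite -[X in measurable X]setTI; apply: emeasurable_fun_c_infty => //.
    by apply: measurableT_comp => //; exact/measurable_EFinP.
  move=> w [k kn ck]; rewrite /= lee_fin ger0_norm ?(ltW (stopped_exp_gt0 _ _ _ _))//.
  exact: le_stopped_exp kn ck.
have := @markov _ _ _ P Z' id _ c0 (@measurable_id _ _ _) (fun r r0 => r0).
rewrite unlock => /(_ _)/le_trans; apply => //.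
rewrite (eq_integral (fun w => (Z w)%:E))// => w _ /=.
by rewrite ger0_norm// ltW// stopped_exp_gt0.
Qed.

End maximal.

(** * The tail bound: choice of the exponent and union over both signs *)

Unset Implicit Arguments.
Set Strict Implicit.

Theorem theorem1 (R : realType) (d : measure_display) (T : measurableType d)
    (P : probability T R) (X : set (R -> R)) (hX : X `<=` calL)
    (f : R -> R) (hf : X f) (n : nat) (hn : (1 <= n)%N)
    (eps : 'I_n -> {RV P >-> R}) (heps : mutually_independent eps)
    (hmean : forall i : 'I_n, ('E_P[eps i] = 0)%E)
    (kappa v : R) (hkappa : 0 < kappa) (hv : 0 < v)
    (hmom : forall (m : nat) (i : 'I_n), (2 <= m)%N ->
      ('E_P[(fun w => `|eps i w| ^+ m)%R]
         <= (v * (m`!)%:R * kappa ^+ (m - 2) / 2)%:E)%E)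
    (delta : R) (hdelta : 0 < delta) :
  let fn : R -> R := step (fun i : 'I_n => f (i%:R / n%:R)) in
  let Yn : T -> R -> R :=
    fun w => step (fun i : 'I_n => f (i%:R / n%:R) + eps i w) in
  (P [set w | (delta <=
         sup [set `|s_ n j (Yn w) - s_ n j fn| | j in [set: nat]])%R]
   <= (2 * expR (- (delta ^+ 2 * n%:R / (2 * v + 2 * kappa * delta))))%:E)%E.
Proof.
cbv zeta.
have n0 : 0 < n%:R :> R by rewrite ltr0n.
pose z : 'I_n -> R := fun i => f (i%:R / n%:R).
pose y w : 'I_n -> R := fun i => f (i%:R / n%:R) + eps i w.
set A := [set w | _].
have -> : A = [set w | delta <= max_s_dist z (y w)] by [].
have mA : measurable [set w | delta <= max_s_dist z (y w)].
  pose Y (i : 'I_n) (w : T) := f (i%:R / n%:R) + eps i w.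
  have mY i : measurable_fun setT (Y i).
    by apply: measurable_funD => //; exact: measurable_cst.
  exact: (@measurable_lipschitz_ge _ _ _ _ (max_s_dist z) Y delta
    (max_s_dist_lipschitz hn z) mY).
have vk : 0 < v + kappa * delta by rewrite addr_gt0// mulr_gt0.
(* With this [l] the Bernstein exponent [q] is exactly half of l delta. *)
pose l := delta / (v + kappa * delta).
have l0 : 0 < l by rewrite divr_gt0.
have k1 : 1 - kappa * l = v / (v + kappa * delta).
  by rewrite /l; field; rewrite gt_eqF.
have kl : kappa * l < 1 by rewrite -subr_gt0 k1 divr_gt0.
pose q := delta ^+ 2 / (2 * (v + kappa * delta)).
have qE : v * l ^+ 2 / (2 * (1 - kappa * l)) = q.
  by rewrite k1 /l /q; field; rewrite !gt_eqF.
(* The level at which a partial sum of the errors has size delta n. *)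
pose c := expR (l * (delta * n%:R)).
have mgf t (i : 'I_n) : `|t| = l ->
    (\int[P]_w (expR (t * eps i w))%:E <= (expR q)%:E)%E.
  move=> tl; rewrite -qE -tl -[`|t| ^+ 2]normrX ger0_norm ?sqr_ge0//.
  by apply: bernstein_mgf; rewrite ?tl// => m m2; exact: hmom.
have q0 : 0 <= q by rewrite divr_ge0 ?sqr_ge0// mulr_ge0// ltW.
have tail t : `|t| = l -> (P (max_exceeds eps c t)
    <= (expR (- (delta ^+ 2 * n%:R / (2 * v + 2 * kappa * delta))))%:E)%E.
  move=> tl; apply: (le_trans (maximal_inequality heps (expR_gt0 _) _
    (fun i => mgf t i tl))).
    by rewrite -expR0 ler_expR.
  (* The exponent is n q - l delta n = - n q. *)
  rewrite lee_fin -expRM_natl -expRN -expRD ler_expR le_eqVlt; apply/orP; left.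
  apply/eqP; rewrite /q /l; field.
  by rewrite !gt_eqF// -?mulrA -?mulrDr ?mulr_gt0.
apply: (@le_trans _ _ (P (max_exceeds eps c l `|` max_exceeds eps c (- l)))).
  apply: le_measure; rewrite ?inE//.
    by apply: measurableU; exact: measurable_max_exceeds.
  move=> w /(max_s_dist_ge hn hdelta)[k kn].
  rewrite (_ : (fun i => _) = (fun i => eps i w)); last first.
    by apply/funext => i; rewrite /y /z addrAC subrr add0r.
  (* The sign of the large partial sum decides which of the two events occurs. *)
  rewrite ler_normr => /orP[] H; [left|right]; exists k => //;
    by rewrite ler_expR ?mulNr -?mulrN ler_pM2l.
apply: (le_trans (measureU2 _ _ _)); try exact: measurable_max_exceeds.
rewrite mulr_natl mulr2n EFinD; apply: leeD; apply: tail.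
- by rewrite gtr0_norm.
- by rewrite normrN gtr0_norm.
Qed.
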